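(* Let $(\mathfrak g,J)$ be a Lie algebra equipped with an almost complex structure $J$ and assume $\mathfrak g$ splits into a direct sum of vector spaces $\mathfrak g=\mathfrak k\oplus\mathfrak h$ such that $J\mathfrak k=\mathfrak h$. Then $\mathfrak g$ always admits a Hermitian and an anti-Hermitian metric for $J$.
   Context: Lie algebras are real and finite-dimensional. An almost complex structure on $\mathfrak g$ is a linear map $J:\mathfrak g\to\mathfrak g$ with $J^2=-1$. A metric on $\mathfrak g$ is a non-degenerate symmetric bilinear form $\langle\cdot,\cdot\rangle:\mathfrak g\times\mathfrak g\to\mathbb R$ (not necessarily definite). It is called Hermitian for $J$ if $\langle Jx,Jy\rangle=\langle x,y\rangle$ for all $x,y\in\mathfrak g$, and anti-Hermitian for $J$ if $\langle Jx,Jy\rangle=-\langle x,y\rangle$ for all $x,y\in\mathfrak g$ (integrability of $J$ is not required). *)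

(* Defs.v *)
From HB Require Import structures.
From mathcomp Require Import all_boot all_order all_algebra reals.

Set Implicit Arguments.
Unset Strict Implicit.
Unset Printing Implicit Defensive.

Import GRing.Theory.
Local Open Scope ring_scope.

HB.mixin Record hasLieBracket (R : fieldType) V of Vector R V := {
  lie : {bilinear V -> V -> V};
  liexx : forall x : V, lie x x = 0;
  lie_jacobi : forall x y z : V,
    lie x (lie y z) + lie y (lie z x) + lie z (lie x y) = 0
}.

#[short(type="lieAlgType")]
HB.structure Definition LieAlgebra (R : fieldType) :=
  { V of hasLieBracket R V & Vector R V }.

Section Metrics.
Variables (R : fieldType) (g : vectType R).

Definition almost_complex (J : 'End(g)) : Prop := forall x, J (J x) = - x.

(* [{symmetric g}] is the library's type of symmetric bilinear forms on [g]:
   Hermitian-type forms with sign +1 and twist [idfun]. *)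
Record metric : Type := Metric {
  metric_form :> {symmetric g};
  metric_nondegenerate : nondegenerate metric_form
}.

Definition Hermitian_metric (J : 'End(g)) (m : metric) : Prop :=
  forall x y, m (J x) (J y) = m x y.

Definition antiHermitian_metric (J : 'End(g)) (m : metric) : Prop :=
  forall x y, m (J x) (J y) = - m x y.

End Metrics.

(* Main.v *)
Require Import Defs.
From HB Require Import structures.
From mathcomp Require Import all_boot all_order all_algebra reals.

Set Implicit Arguments.
Unset Strict Implicit.
Unset Printing Implicit Defensive.

Import GRing.Theory Num.Theory VectorInternalTheory.
Local Open Scope ring_scope.

(** Let [b] be a positive definite form on [g] and [p] the projection onto [k]
    along [h]. The pullback [beta x y = b (p x) (p y)] is symmetric with radical
    [h]. Since [J^2 = -1], pulling [beta] back twice by [J] gives [beta] again,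
    so for a sign [s] (with [s^2 = 1]) the symmetrization
    [m = beta + s * J^* beta] satisfies [m (J x) (J y) = s * m x y]: it is
    Hermitian for [s = 1] and anti-Hermitian for [s = -1]
    ([pullback_form_twist]).

    The splitting enters in the non-degeneracy ([pullback_form_nondegenerate]).
    As [J] maps [k] into [h], the summand [J^* beta] vanishes on [k], so pairing
    [x] with [p x] leaves [b (p x) (p x)]. An element [x] of the radical thus
    has [p x = 0]; the radical is stable under [J], so [p (J x) = 0] as well.
    Hence both [x] and [J x] lie in [h]; as [h = J k], this puts [J x] in
    [k] too, and [x = 0]. *)

Section DotProduct.
Variables (F : realFieldType) (V : vectType F).

Definition dotv (x y : V) : F := \sum_i v2r x 0 i * v2r y 0 i.

Lemma dotvC x y : dotv x y = dotv y x.
Proof. by apply: eq_bigr => i _; rewrite mulrC. Qed.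

Lemma dotvP a x y z : dotv (a *: x + y) z = a * dotv x z + dotv y z.
Proof.
rewrite /dotv mulr_sumr -big_split; apply: eq_bigr => i _ /=.
by rewrite linearP !mxE mulrDl mulrA.
Qed.

Lemma dot0v x : dotv 0 x = 0.
Proof. by rewrite /dotv big1 // => i _; rewrite linear0 mxE mul0r. Qed.

Lemma dotNv x y : dotv (- x) y = - dotv x y.
Proof. by have := dotvP (-1) x 0 y; rewrite dot0v !addr0 scaleN1r mulN1r. Qed.

Lemma dotvv_eq0 x : dotv x x = 0 -> x = 0.
Proof.
move=> /psumr_eq0P dx0; apply: (can_inj v2rK); rewrite linear0.
apply/rowP => i; rewrite mxE; apply/eqP; rewrite -sqrf_eq0 expr2.
by rewrite dx0 // => j _; rewrite -expr2 sqr_ge0.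
Qed.

End DotProduct.

Section PullbackForm.
Variables (F : realFieldType) (V : vectType F) (J p : 'End(V)) (s : F).

(** This is [beta + s * J^* beta], where [beta] is the pullback of the dot
    product by [p]. *)
Definition pullback_form (x y : V) : F :=
  dotv (p x) (p y) + s * dotv (p (J x)) (p (J y)).

Lemma pullback_formC x y : pullback_form x y = pullback_form y x.
Proof. by rewrite /pullback_form dotvC [dotv (p (J x)) _]dotvC. Qed.

Lemma pullback_formP a x y z :
  pullback_form (a *: x + y) z = a * pullback_form x z + pullback_form y z.
Proof.
by rewrite /pullback_form !linearP /= !dotvP !mulrDr addrACA mulrCA.
Qed.

Lemma pullback_form_bilinear :
  bilinear_for ( *%R : F -> F -> F) (idfun \; *%R) pullback_form.
Proof.
split=> [z a x y|z a x y] /=; first exact: pullback_formP.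
by rewrite !(pullback_formC z) pullback_formP.
Qed.

HB.instance Definition _ :=
  bilinear_isBilinear.Build F V V F _ _ pullback_form pullback_form_bilinear.

Fact pullback_form_symmetric x y :
  pullback_form x y = (-1) ^+ false * idfun (pullback_form y x).
Proof. by rewrite mul1r pullback_formC. Qed.

HB.instance Definition _ :=
  isHermitianSesquilinear.Build F V false idfun pullback_form
    pullback_form_symmetric.

Hypothesis JJ : almost_complex J.
Hypothesis ss1 : s * s = 1.

(** Pulling back by [J] sends [J^* beta] to [beta], both arguments being negated
    by [J^2 = -1]; as [s] is its own inverse, swapping the two summands amounts
    to multiplying by [s]. *)
Lemma pullback_form_twist x y :
  pullback_form (J x) (J y) = s * pullback_form x y.
Proof.
have JJN u v : dotv (p (J (J u))) v = - dotv (p u) v.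
  by rewrite JJ linearN; apply: dotNv.
rewrite /pullback_form JJN [dotv (p x) _]dotvC JJN opprK [dotv (p y) _]dotvC.
by rewrite mulrDr mulrA ss1 mul1r addrC.
Qed.

End PullbackForm.

Section Splitting.
Variables (F : realFieldType) (V : vectType F) (J : 'End(V)).
Variables (k h : {vspace V}).
Hypotheses (JJ : almost_complex J) (kh0 : (k :&: h = 0)%VS).
Hypotheses (khT : (k + h)%VS = fullv) (Jk : (J @: k)%VS = h).

Local Notation p := (daddv_pi k h).

Lemma daddv_pi_eq0 x : (p x == 0) = (x \in h).
Proof.
have pD : p x + daddv_pi h k x = x by rewrite daddv_pi_add // khT memvf.
apply/eqP/idP => [px0|xh]; first by rewrite -pD px0 add0r memv_pi.
by apply: (addIr x); rewrite -{2}(@daddv_pi_id _ _ h k x) 1?capvC // pD add0r.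
Qed.

(** Since [h = J k], an [x] in [h] is [J z] with [z] in [k], and then
    [J x = - z] can lie in [h] only if [z = 0]: [h] is totally real. *)
Lemma totally_real_eq0 x : x \in h -> J x \in h -> x = 0.
Proof.
rewrite -{1}Jk => /memv_imgP[z zk ->]; rewrite JJ memvN => zh.
have: z \in (k :&: h)%VS by rewrite memv_cap zk.
by rewrite kh0 memv0 => /eqP ->; rewrite linear0.
Qed.

(** Elements of the radical lie in [h], as pairing with [p x] shows; the radical
    is [J]-stable by the twist identity, and [h] is totally real. *)
Lemma pullback_form_nondegenerate s :
  s * s = 1 -> nondegenerate (pullback_form J p s : {symmetric V}).
Proof.
move=> ss1; rewrite /nondegenerate -subv0; apply/subvP => x /mem_orthovP xrad.
have radP y : (forall z, pullback_form J p s y z = 0) -> y \in h.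
  (* [J] maps [p y] into [h], so only [dotv (p y) (p y)] survives. *)
  move=> /(_ (p y)); rewrite /pullback_form.
  have /eqP -> : p (J (p y)) == 0 by rewrite daddv_pi_eq0 -Jk memv_img ?memv_pi.
  rewrite [X in s * X]dotvC dot0v mulr0 addr0 daddv_pi_proj // => /dotvv_eq0.
  by move/eqP; rewrite daddv_pi_eq0.
have x0 z : pullback_form J p s x z = 0 by apply: xrad; rewrite memvf.
rewrite memv0; apply/eqP/totally_real_eq0; apply: radP => // z.
(* The twist identity needs both arguments in the image of [J]. *)
have -> : z = J (- J z) by rewrite linearN /= JJ opprK.
by rewrite pullback_form_twist // x0 mulr0.
Qed.

Lemma exists_twisted_metric s : s * s = 1 ->
  exists m : metric V, forall x y, m (J x) (J y) = s * m x y.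
Proof.
move=> ss1; exists (Metric (pullback_form_nondegenerate ss1)) => x y.
exact: pullback_form_twist.
Qed.

End Splitting.

Theorem proposition4p4 (R : realType) (g : lieAlgType R) (J : 'End(g))
    (k h : {vspace g}) :
  almost_complex J ->
  directv (k + h)%VS -> (k + h)%VS = fullv ->
  (J @: k)%VS = h ->
  (exists m : metric g, Hermitian_metric J m) /\
  (exists m : metric g, antiHermitian_metric J m).
Proof.
move=> JJ /directv_addP kh0 khT Jk.
have exm s := exists_twisted_metric JJ kh0 khT Jk (s := s).
split.
  by have [m mJ] := exm 1 (mulr1 1); exists m => x y; rewrite mJ mul1r.
have [m mJ] := exm (-1) (etrans (mulrNN 1 1) (mulr1 1)).
by exists m => x y; rewrite mJ mulN1r.
Qed.
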